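(* Let $n\in\mathbb{N}$ with $n>447$ and $x=12n+4$. If the set $\mathscr{A}(x)$ of divisibility events for $x$ is nearly independent, then $x$ can be expressed as the sum of two odd primes.
   Context: $\mathbb{N}$ denotes the positive integers. For $x=12n+4$ let $S(n)=\{12m+6: m\in\mathbb{N}\cup\{0\},\ m<n\}$, with the uniform probability $P(E)=|E|/n$ for $E\subseteq S(n)$. Let $p_1=5<p_2=7<\cdots<p_r$ be the primes $p$ with $3<p<\sqrt{x}$, in increasing order. For each such prime $p$, the event $A_p$ is $A_p=\{y\in S(n): p\mid x+y\}\cup\{y\in S(n): p\mid x-y,\ x-y\ne 2p\}$. The set of divisibility events for $x$ is $\mathscr{A}(x)=\{A_{p_1},\ldots,A_{p_r}\}$ (in this order). For events $A,B$ let $\lambda(A,B)=\frac{P(B)-P(A\cap B)}{P(B)-P(A)P(B)}$. A (finite, ordered) collection of events $\{A_1,\ldots,A_r\}$ is called nearly independent if $\lambda_0<2.5$, where $\lambda_i=\lambda\big(\bigcup_{j=1}^{i-1}A_j,A_i\big)$ and $\lambda_0=\max\{\lambda_i: i=2,\ldots,r\}$ (the denominators being understood to be nonzero). *)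

(* Defs.v *)
From mathcomp Require Import all_boot all_order all_algebra finmap.

Set Implicit Arguments.
Unset Strict Implicit.
Unset Printing Implicit Defensive.

Import Order.TTheory GRing.Theory Num.Theory.

Local Open Scope fset_scope.
Local Open Scope nat_scope.

Definition goldbach_x (n : nat) : nat := 12 * n + 4.

Definition sample_space (n : nat) : {fset nat} :=
  [fset 12 * m + 6 | m in iota 0 n].

Definition prob (n : nat) (E : {fset nat}) : rat := (#|` E|%:R / n%:R)%R.

(* Every y in S(n) satisfies y < x, so the truncated subtraction x - y is the
   true difference. *)
Definition div_event (n p : nat) : {fset nat} :=
  let x := goldbach_x n in
  [fset y in sample_space n | p %| x + y]
  `|` [fset y in sample_space n | (p %| x - y) && (x - y != 2 * p)].

(* The condition p < sqrt x is written p ^ 2 < x; the list is increasing. *)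
Definition sieving_primes (x : nat) : seq nat :=
  [seq p <- iota 0 x | [&& prime p, 3 < p & p ^ 2 < x]].

Definition divisibility_events (n : nat) : seq {fset nat} :=
  [seq div_event n p | p <- sieving_primes (goldbach_x n)].

Definition lambda_den (n : nat) (A B : {fset nat}) : rat :=
  (prob n B - prob n A * prob n B)%R.

Definition lambda (n : nat) (A B : {fset nat}) : rat :=
  ((prob n B - prob n (A `&` B)) / lambda_den n A B)%R.

(* Events are numbered from 1: E = [:: A_1; ...; A_r]. *)
Definition event (E : seq {fset nat}) (i : nat) : {fset nat} :=
  nth fset0 E i.-1.

Definition union_before (E : seq {fset nat}) (i : nat) : {fset nat} :=
  \big[fsetU/fset0]_(1 <= j < i) event E j.

Definition lambda_at (n : nat) (E : seq {fset nat}) (i : nat) : rat :=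
  lambda n (union_before E i) (event E i).

(* The iterated maximum is seeded with lambda_2, so that for r >= 2 it is
   exactly max {lambda_i : 2 <= i <= r}, with no artificial extra value. *)
Definition lambda_max (n : nat) (E : seq {fset nat}) : rat :=
  \big[Num.max/lambda_at n E 2]_(2 <= i < (size E).+1) lambda_at n E i.

(* Division by zero is total in MathComp (a / 0 = 0), so the requirement that
   each lambda_i be defined has to be stated explicitly. *)
Definition nearly_independent (n : nat) (E : seq {fset nat}) : Prop :=
  (forall i, 2 <= i <= size E ->
     lambda_den n (union_before E i) (event E i) != 0%R)
  /\ (lambda_max n E < 5%:R / 2%:R)%R.

(* Main.v *)
Require Import Defs.
From mathcomp Require Import all_boot all_order all_algebra finmap.
From mathcomp Require Import zify lra.

(** Write y = 12m + 6.  Then (x + y) / 2 = 6(n + m) + 5 and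
    (x - y) / 2 = 6(n - m) - 1 are coprime to 6, lie strictly between 1 and x,
    and add up to x.  If y lies in no A_p, neither has a prime factor below
    sqrt x (except possibly itself), so both are prime
    ([goldbach_of_unsieved]).  Hence it suffices that the events A_p do not
    cover S(n), that is, that their union has probability less than 1.

    This is proved by adding the events one at a time.  With U the union of
    the earlier events and A_i the new one, the definition of lambda_i gives
      P(A_i) - P(U /\ A_i) = lambda_i * P(A_i) * (1 - P(U)),
    so as long as P(U) < 1 the new event keeps the union away from 1 when
    lambda_i * P(A_i) < 1 ([prob_fsetU_lt1]).  Since lambda_i < 5/2, the bound
    P(A_i) <= 2/5 is enough.  Each A_p meets at most two residue classes
    mod p, so it has at most 2(n/p + 1) elements ([card_div_event]), and this
    is at most 2n/5 for p > 5 and n >= 30.  The prime 5, whose event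
    may be slightly too large for that bound, comes first, where P(A_5) < 1 suffices. *)

Set Implicit Arguments.
Unset Strict Implicit.
Unset Printing Implicit Defensive.

Import Order.TTheory GRing.Theory Num.Theory.

Local Open Scope fset_scope.
Local Open Scope nat_scope.

(** * Sizes of the divisibility events *)

Lemma sample_spaceP n y :
  reflect (exists2 m, m < n & y = 12 * m + 6) (y \in sample_space n).
Proof.
apply: (iffP (imfsetP _ _ _ _)) => -[m /= hm ->]; exists m => //;
  by move: hm; rewrite /= ?mem_iota ?add0n.
Qed.

Lemma prime_gt3_coprime12 p : prime p -> 3 < p -> coprime p 12.
Proof.
move=> pp p3; rewrite prime_coprime // (_ : 12 = 2 * 2 * 3) //.
by rewrite !Euclid_dvdM // !dvdn_prime2 //; lia.
Qed.

Lemma coprime_eqn_modMl d a m k : coprime d a ->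
  (a * m == a * k %[mod d]) = (m == k %[mod d]).
Proof.
move=> cop; wlog lekm : m k / k <= m => [hw|].
  have [|/ltnW] := leqP k m; first exact: hw.
  by rewrite eq_sym [RHS]eq_sym; apply: hw.
by rewrite !eqn_mod_dvd ?leq_mul2l ?lekm ?orbT // -mulnBr Gauss_dvdr.
Qed.

(** The quotients of m by p, for y = 12m + 6 in the class, are distinct and
    at most n / p: a repetition would put two congruent values of m in the
    same block of length p. *)
Lemma card_residue_class n p (E : {fset nat}) :
  coprime p 12 -> {subset E <= sample_space n} ->
  {in E &, forall y z, y = z %[mod p]} -> #|` E| <= (n %/ p).+1.
Proof.
move=> cop sub cong.
pose f y := ((y - 6) %/ 12) %/ p.
have finj : {in E &, injective f}.
  move=> y z yE zE.
  have /sample_spaceP[m mn ym] := sub _ yE.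
  have /sample_spaceP[k kn zk] := sub _ zE.
  have /eqP := cong _ _ yE zE.
  rewrite /f ym zk eqn_modDr !addnK !mulKn // coprime_eqn_modMl //.
  by move=> /eqP hmk hd; rewrite (divn_eq m p) (divn_eq k p) hd hmk.
have := @uniq_leq_size _ (map f (enum_fset E)) (iota 0 (n %/ p).+1).
rewrite size_map size_iota; apply.
  by rewrite map_inj_in_uniq //; apply: fset_uniq.
move=> _ /mapP[y yE ->]; have /sample_spaceP[m mn ->] := sub _ yE.
by rewrite mem_iota add0n ltnS /f addnK mulKn // leq_div2r // ltnW.
Qed.

Lemma sample_space_lt n y : y \in sample_space n -> y < goldbach_x n.
Proof. by move=> /sample_spaceP[m mn ->]; rewrite /goldbach_x; lia. Qed.

(** The two pieces of A_p lie in the classes of -x and of x modulo p. *)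
Lemma card_div_event n p : prime p -> 3 < p ->
  #|` div_event n p| <= 2 * (n %/ p).+1.
Proof.
move=> pp p3; have cop := prime_gt3_coprime12 pp p3.
rewrite mul2n -addnn /div_event; set x := goldbach_x n.
rewrite cardfsU; apply: leq_trans (leq_subr _ _) _; apply: leq_add.
  apply: card_residue_class => // [y|y z]; first by rewrite !inE => /andP[].
  rewrite !inE => /andP[_ /eqP hy] /andP[_ /eqP hz].
  by apply/eqP; rewrite -(eqn_modDl x) hy hz.
apply: card_residue_class => // [y|y z]; first by rewrite !inE => /andP[].
rewrite !inE => /andP[/sample_space_lt/ltnW hy /andP[dy _]].
move=> /andP[/sample_space_lt/ltnW hz /andP[dz _]].
move: dy dz; rewrite -!eqn_mod_dvd // => /eqP <- /eqP <-.
by [].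
Qed.

Local Open Scope ring_scope.

Lemma prob_ge0 n E : 0 <= prob n E.
Proof. by rewrite divr_ge0 ?ler0n. Qed.

Lemma prob_div_event_lt1 n p : (4 < n)%N -> prime p -> (3 < p)%N ->
  prob n (div_event n p) < 1.
Proof.
move=> hn pp p3; have n0 : (0 < n)%N by lia.
rewrite /prob ltr_pdivrMr ?ltr0n // mul1r ltr_nat.
apply: leq_ltn_trans (card_div_event n pp p3) _.
have := leq_divM n p; have : (n %/ p <= n %/ 4)%N by apply: leq_div2l.
by lia.
Qed.

(** Here 2(n/p + 1) <= 2n/6 + 2, which is at most 2n/5 once n >= 30. *)
Lemma prob_div_event_le n p : (30 <= n)%N -> prime p -> (5 < p)%N ->
  prob n (div_event n p) <= 2%:R / 5%:R.
Proof.
move=> hn pp p5; have n0 : (0 < n)%N by lia.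
rewrite /prob ler_pdivrMr ?ltr0n // mulrAC ler_pdivlMr ?ltr0n //.
rewrite -!natrM ler_nat.
have := card_div_event n pp (ltn_trans (isT : 3 < 5)%N p5).
have : (n %/ p <= n %/ 6)%N by apply: leq_div2l.
by lia.
Qed.

(** * Adding the events one at a time *)

Lemma probU n A B :
  prob n (A `|` B) = prob n A + prob n B - prob n (A `&` B).
Proof.
rewrite /prob -mulrDl -mulrBl; congr (_ / _).
by rewrite -natrD -cardfsUI natrD addrK.
Qed.

(** The new event takes the fraction lambda * P(B) of the complement of A. *)
Lemma prob_fsetU_lt1 n A B (c : rat) :
  lambda_den n A B != 0 -> lambda n A B < c -> c * prob n B <= 1 ->
  prob n A < 1 -> prob n (A `|` B) < 1.
Proof.
rewrite probU /lambda /lambda_den => den0 hl hc hA.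
have hB := prob_ge0 n B.
have den_gt0 : 0 < prob n B - prob n A * prob n B.
  by rewrite lt_def den0 /=; nra.
by move: hl; rewrite ltr_pdivrMr //; nra.
Qed.

Lemma union_beforeS E i : (0 < i)%N ->
  union_before E i.+1 = union_before E i `|` event E i.
Proof. by move=> i0; rewrite /union_before big_nat_recr. Qed.

Lemma lambda_at_le_max n E i : (2 <= i <= size E)%N ->
  lambda_at n E i <= lambda_max n E.
Proof.
by move=> hi; apply: le_bigmax_seq => //; rewrite mem_index_iota ltnS.
Qed.

Lemma prob_union_lt1 n (E : seq {fset nat}) :
  nearly_independent n E -> prob n (event E 1) < 1 ->
  (forall i, (2 <= i <= size E)%N -> prob n (event E i) <= 2%:R / 5%:R) ->
  prob n (union_before E (size E).+1) < 1.
Proof.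
move=> [den0 hmax] h1 h2.
suff H k : (k <= size E)%N -> prob n (union_before E k.+1) < 1 by exact: H.
elim: k => [|k IH] hk.
  by rewrite /union_before big_geq // /prob cardfs0 mul0r ltr01.
rewrite union_beforeS //; case: k IH hk => [|k] IH hk.
  by rewrite /union_before big_geq // fset0U.
have hi : (2 <= k.+2 <= size E)%N by [].
apply: (prob_fsetU_lt1 (den0 _ hi) (le_lt_trans (lambda_at_le_max n hi) hmax)).
  by have := h2 _ hi; lra.
by apply: IH; apply: ltnW.
Qed.

Lemma prob_ge1_cover n E : (0 < n)%N -> {subset sample_space n <= E} ->
  1 <= prob n E.
Proof.
move=> n0 sub; rewrite /prob ler_pdivlMr ?ltr0n // mul1r ler_nat.
have := @uniq_leq_size _ [seq (12 * m + 6)%N | m <- iota 0 n] (enum_fset E).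
rewrite size_map size_iota; apply.
  by rewrite map_inj_uniq ?iota_uniq // => i j; lia.
move=> y /mapP[m]; rewrite mem_iota => hm ->; apply: sub.
by apply/sample_spaceP; exists m.
Qed.

Local Close Scope ring_scope.

(** * The sieve *)

Lemma mem_sieving_primes x p :
  p \in sieving_primes x = [&& prime p, 3 < p & p ^ 2 < x].
Proof.
rewrite mem_filter mem_iota add0n /=; apply: andb_idr => /and3P[_ p3 px].
by apply: leq_ltn_trans px; rewrite expnS expn1; nia.
Qed.

(** Only the first sieving prime can be 5: the list increases strictly. *)
Lemma sieving_prime_gt5 x i : 0 < i < size (sieving_primes x) ->
  5 < nth 0 (sieving_primes x) i.
Proof.
move=> /andP[i0 isz]; set s := sieving_primes x in isz *.
have ss : sorted ltn s.
  by apply: sorted_filter; [exact: ltn_trans | exact: iota_ltn_sorted].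
have h0 : nth 0 s 0 < nth 0 s i.
  by apply: (sorted_ltn_nth ltn_trans) => //; rewrite inE (ltn_trans i0).
have : nth 0 s 0 \in s by apply: mem_nth; apply: ltn_trans isz.
rewrite mem_sieving_primes; move: h0; move: (nth 0 s 0) => q hq.
case/and3P => pq q3 _; have : q != 4 by apply: contraTneq pq => ->.
by lia.
Qed.

(** The least prime factor of a composite a has square at most a < x, so the
    sieve would force it to be a itself; hence the exception p = a is
    harmless. *)
Lemma prime_of_unsieved x a : 1 < a < x ->
  (forall p, prime p -> p ^ 2 < x -> p %| a -> p = a) -> prime a.
Proof.
move=> /andP[a1 ax] h; have [|le_pa] := ltnP a (pdiv a ^ 2).
  by apply: ltn_pdiv2_prime; apply: ltnW.
have pp := pdiv_prime a1.
by rewrite -(h _ pp (leq_ltn_trans le_pa ax) (pdiv_dvd a)).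
Qed.

Lemma goldbach_of_unsieved n y : y \in sample_space n ->
  (forall p, p \in sieving_primes (goldbach_x n) -> y \notin div_event n p) ->
  exists p q : nat,
    [/\ prime p, odd p, prime q, odd q & goldbach_x n = p + q].
Proof.
move=> yS unsieved; have /sample_spaceP[m mn ym] := yS.
have sieved p : prime p -> 3 < p -> p ^ 2 < goldbach_x n ->
    ~~ (p %| goldbach_x n + y) /\
    (p %| goldbach_x n - y -> goldbach_x n - y = 2 * p).
  move=> pp p3 px; have := unsieved p; rewrite mem_sieving_primes pp p3 px.
  move=> /(_ isT); rewrite /div_event !inE yS /= negb_or negb_and negbK.
  by case/andP=> -> h; split=> // d; move: h; rewrite d /= => /eqP.
have sumE : goldbach_x n + y = 2 * (6 * (n + m) + 5).
  by rewrite ym /goldbach_x; lia.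
have difE : goldbach_x n - y = 2 * (6 * (n - m) - 1).
  by rewrite ym /goldbach_x; lia.
have gt3 p a : prime p -> p %| a -> ~~ (2 %| a) -> ~~ (3 %| a) -> 3 < p.
  by case: p => [|[|[|[|p]]]] // _ ->.
exists (6 * (n + m) + 5), (6 * (n - m) - 1); split; try lia.
- apply: (@prime_of_unsieved (goldbach_x n)); first by rewrite /goldbach_x; lia.
  move=> p pp px pd; have p3 : 3 < p by apply: gt3 pd _ _ => //; lia.
  have [+ _] := sieved p pp p3 px.
  by rewrite sumE dvdn_mull.
- apply: (@prime_of_unsieved (goldbach_x n)); first by rewrite /goldbach_x; lia.
  move=> p pp px pd; have p3 : 3 < p by apply: gt3 pd _ _ => //; lia.
  have [_] := sieved p pp p3 px.
  by rewrite difE dvdn_mull // => /(_ isT); lia.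
Qed.

Theorem theorem6p9 (n : nat) (hn : 447 < n)
  (hind : nearly_independent n (divisibility_events n)) :
  exists p q : nat,
    [/\ prime p, odd p, prime q, odd q & goldbach_x n = p + q].
Proof.
have n0 : 0 < n by apply: ltn_trans hn.
set E := divisibility_events n in hind; set s := sieving_primes (goldbach_x n).
have szE : size E = size s by rewrite size_map.
have eventE i : i < size s -> event E i.+1 = div_event n (nth 0 s i).
  by move=> hi; rewrite /event (nth_map 0).
have mem_s i : i < size s -> prime (nth 0 s i) /\ 3 < nth 0 s i.
  by move=> /(mem_nth 0); rewrite mem_sieving_primes => /and3P[].
have lt1 : (prob n (union_before E (size E).+1) < 1)%R.
  apply: prob_union_lt1 => //.
    (* For an empty list, [event E 1] is the default value [fset0]. *)
    have [s0|s0] := posnP (size s); last first.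
      by rewrite eventE //; have [pp p3] := mem_s 0 s0; apply: prob_div_event_lt1 => //; apply: ltn_trans hn.
    by rewrite /event nth_default ?szE ?s0 // /prob cardfs0 mul0r ltr01.
  case=> [|i] //; rewrite szE ltnS => /andP[i0 hi]; rewrite eventE //.
  have [pp _] := mem_s i hi; apply: prob_div_event_le => //; first by apply: ltnW (ltn_trans _ hn).
  by apply: sieving_prime_gt5; rewrite i0.
have /allPn[y yS yU] : ~~ all (mem (union_before E (size E).+1)) (sample_space n).
  apply: contraTN lt1 => /allP cover; rewrite -leNgt.
  exact: prob_ge1_cover.
apply: (goldbach_of_unsieved yS) => p ps; apply: contra yU => yp.
have hi : index p s < size s by rewrite index_mem.
rewrite /= /union_before (bigD1_seq (index p s).+1) ?iota_uniq //=.
  by rewrite inE eventE // nth_index // yp.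
by rewrite mem_index_iota szE !ltnS.
Qed.
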